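(* For $q^\gamma\neq 1,q^{-1},q^{-2},\dots$, the following transformation formula holds: $$\mathbf{\Phi}_{1}(q^{\alpha},q^{\beta};q^{\gamma};q,x,y)=\frac{(q^{\alpha},xq^{\beta};q)_{\infty}}{(q^{\gamma},x,y;q)_{\infty}}\;{}_{3}\mathbf{\Phi}_{2}(q^{\gamma-\alpha},x,y;q^{\beta}x,0;q,q^{\alpha}).$$
   Context: Let $q\in\mathbb{C}$ with $0<|q|<1$. The $q$-shifted factorial is $(a;q)_0=1$, $(a;q)_\ell=\prod_{j=0}^{\ell-1}(1-aq^j)$ for $\ell\ge 1$ (so $(0;q)_\ell=1$), $(a;q)_\infty=\prod_{j=0}^\infty(1-aq^j)$, and $(a_1,\dots,a_m;q)_\infty=\prod_{i=1}^m(a_i;q)_\infty$. The basic hypergeometric series is ${}_{3}\mathbf{\Phi}_{2}(a,b,c;d,e;q,z)=\sum_{s=0}^{\infty}\frac{(a;q)_s(b;q)_s(c;q)_s}{(q;q)_s(d;q)_s(e;q)_s}z^s$. The basic Humbert hypergeometric function $\mathbf{\Phi}_1$ is defined by the double series $$\mathbf{\Phi}_{1}(q^{\alpha},q^{\beta};q^{\gamma};q,x,y)=\sum_{n,k=0}^{\infty}\frac{(q^{\alpha};q)_{n+k}(q^{\beta};q)_{n}}{(q^{\gamma};q)_{n+k}(q;q)_{n}(q;q)_{k}}x^{n}y^{k},\qquad q^\gamma\neq 1,q^{-1},q^{-2},\dots.$$ *)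

(* Defs.v *)
From Stdlib Require Import Reals.
From Coquelicot Require Import Coquelicot.

Open Scope C_scope.

Definition Cexp (z : C) : C :=
  ((exp (Re z) * cos (Im z))%R, (exp (Re z) * sin (Im z))%R).

(* [q^alpha] for complex [alpha] needs a choice of logarithm of [q]: [lq] is
   any complex number with [Cexp lq = q], and the same one is used for every
   exponent. *)
Definition qpow (lq alpha : C) : C := Cexp (alpha * lq).

(* Limits and sums of complex sequences, taken on the real and imaginary parts;
   as with [Lim_seq] and [Series], the value is only meaningful when the
   sequence or series converges. *)
Definition CLim (u : nat -> C) : C :=
  (real (Lim_seq (fun n => Re (u n))), real (Lim_seq (fun n => Im (u n)))).

Definition CSeries (a : nat -> C) : C := CLim (sum_n a).

Definition ex_Cseries (a : nat -> C) : Prop :=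
  @ex_series C_AbsRing C_NormedModule a.

(* Absolute convergence of [sum_(n,k) a n k]. The partial sums of an absolutely
   convergent double series converge to the same value along every exhaustion
   of [nat * nat] by finite sets; [CDSeries] uses the squares. *)
Definition ex_CDseries (a : nat -> nat -> C) : Prop :=
  exists M : R, forall N K : nat,
    (sum_n (fun n => sum_n (fun k => Cmod (a n k)) K) N <= M)%R.

Definition CDSeries (a : nat -> nat -> C) : C :=
  CLim (fun N => sum_n (fun n => sum_n (fun k => a n k) N) N).

Fixpoint qpoch (a q : C) (l : nat) : C :=
  match l with
  | O => 1
  | S l' => qpoch a q l' * (1 - a * q ^ l')
  end.

Definition qpoch_inf (a q : C) : C := CLim (qpoch a q).

Definition phi32_term (a b c d e q z : C) (s : nat) : C :=
  (qpoch a q s * qpoch b q s * qpoch c q s)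
  / (qpoch q q s * qpoch d q s * qpoch e q s) * z ^ s.

Definition phi32 (a b c d e q z : C) : C :=
  CSeries (phi32_term a b c d e q z).

(* The parameters [a], [b], [c] stand for [q^alpha], [q^beta], [q^gamma]. *)
Definition Phi1_term (a b c q x y : C) (n k : nat) : C :=
  (qpoch a q (n + k) * qpoch b q n)
  / (qpoch c q (n + k) * qpoch q q n * qpoch q q k) * x ^ n * y ^ k.

Definition Phi1 (a b c q x y : C) : C := CDSeries (Phi1_term a b c q x y).

(* [a] is none of [1, q^-1, q^-2, ...], i.e. no factor [1 - a * q^m] vanishes. *)
Definition not_qpole (a q : C) : Prop := forall m : nat, a <> / (q ^ m).

(* Main.v *)
Require Import Defs.
From Stdlib Require Import Reals Lra Lia Classical.
From Coquelicot Require Import Coquelicot.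

Open Scope C_scope.

(** Write [a], [b], [c] for [q^alpha], [q^beta], [q^gamma] and [d = c / a]. The
    q-binomial theorem [(z)_inf * sum_s (d)_s / (q)_s z^s = (d z)_inf] at
    [z = a q^N] expands [(a)_N / (c)_N] as
    [(a)_inf / (c)_inf * sum_s (d)_s / (q)_s a^s q^(N s)]. Inserting this with
    [N = n + k] in [Phi1] separates the sums over [n] and [k], and each of them is
    again a q-binomial series, at [x q^s] and [y q^s]. The interchange of sums is a
    dominated convergence in [s], since the partial sums over [n] and [k] converge
    uniformly in [s].

    The q-binomial theorem is proved for every [z] at which the series converges
    absolutely, by iterating [(1 - z) f(z) = (1 - d z) f(q z)]; this covers at once
    [|z| < 1] and terminating series with arbitrary [z]. *)

(** * Limits of complex sequences, measured in modulus *)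

Definition is_Clim (u : nat -> C) (l : C) : Prop :=
  is_lim_seq (fun n => Cmod (u n - l)) 0.

Lemma is_lim_seq_squeeze0 (u e : nat -> R) :
  (forall n, 0 <= u n <= e n)%R -> is_lim_seq e 0 -> is_lim_seq u 0.
Proof.
  intros H He.
  apply (is_lim_seq_le_le (fun _ => 0%R) u e); auto using is_lim_seq_const.
Qed.

Lemma is_Clim_squeeze (u : nat -> C) (l : C) (e : nat -> R) :
  (forall n, Cmod (u n - l) <= e n)%R -> is_lim_seq e 0 -> is_Clim u l.
Proof.
  intros H He. apply is_lim_seq_squeeze0 with e; auto.
  intros n; split; auto using Cmod_ge_0.
Qed.

Lemma im_le_Cmod (z : C) : (Rabs (Im z) <= Cmod z)%R.
Proof.
  eapply Rle_trans; [|apply Rmax_Cmod]. apply Rmax_r.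
Qed.

Lemma is_Clim_CLim (u : nat -> C) (l : C) : is_Clim u l -> CLim u = l.
Proof.
  intros H. unfold CLim.
  (* One argument serves both coordinates: all it needs of [Re] and [Im] is compatibility with
     subtraction and domination by the modulus. *)
  assert (E : forall f : C -> R, (forall z w : C, f (z - w)%C = f z - f w)%R ->
    (forall z, Rabs (f z) <= Cmod z)%R -> Lim_seq (fun n => f (u n)) = f l).
  { intros f fB fle. apply is_lim_seq_unique.
    apply is_lim_seq_ext with (fun n => (f (u n) - f l) + f l)%R; [intros; ring|].
    replace (Finite (f l)) with (Rbar_plus 0 (f l)) by (simpl; f_equal; ring).
    apply is_lim_seq_plus'; [|apply is_lim_seq_const].
    apply is_lim_seq_abs_0. apply is_lim_seq_squeeze0 with (2 := H).
    intros n; split; [apply Rabs_pos|]. cbv beta. rewrite <- fB. apply fle. }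
  rewrite (E Re), (E Im); auto using re_le_Cmod, im_le_Cmod.
  now destruct l.
Qed.

Lemma is_Clim_unique (u : nat -> C) (l l' : C) : is_Clim u l -> is_Clim u l' -> l = l'.
Proof.
  intros H H'. rewrite <- (is_Clim_CLim _ _ H). now apply is_Clim_CLim.
Qed.

Lemma is_Clim_ext (u v : nat -> C) (l : C) :
  (forall n, u n = v n) -> is_Clim u l -> is_Clim v l.
Proof.
  intros E. apply is_lim_seq_ext. intros n. now rewrite E.
Qed.

Lemma is_Clim_const (l : C) : is_Clim (fun _ => l) l.
Proof.
  apply is_Clim_squeeze with (fun _ => 0%R); [|apply is_lim_seq_const].
  intros _. replace (l - l) with (RtoC 0) by ring. rewrite Cmod_0. apply Rle_refl.
Qed.

Lemma is_Clim_plus (u v : nat -> C) (l m : C) :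
  is_Clim u l -> is_Clim v m -> is_Clim (fun n => u n + v n) (l + m).
Proof.
  intros Hu Hv.
  apply is_Clim_squeeze with (fun n => Cmod (u n - l) + Cmod (v n - m))%R.
  - intros n. replace (u n + v n - (l + m)) with ((u n - l) + (v n - m)) by ring.
    apply Cmod_triangle.
  - replace (Finite 0) with (Rbar_plus 0 0) by (simpl; f_equal; ring).
    now apply is_lim_seq_plus'.
Qed.

Lemma is_Clim_Cmod (u : nat -> C) (l : C) :
  is_Clim u l -> is_lim_seq (fun n => Cmod (u n)) (Cmod l).
Proof.
  intros H.
  apply is_lim_seq_ext with (fun n => (Cmod (u n) - Cmod l) + Cmod l)%R; [intros; ring|].
  replace (Finite (Cmod l)) with (Rbar_plus 0 (Cmod l)) by (simpl; f_equal; ring).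
  apply is_lim_seq_plus'; [|apply is_lim_seq_const].
  apply is_lim_seq_abs_0. apply is_lim_seq_squeeze0 with (2 := H).
  intros n; split; [apply Rabs_pos|].
  apply Rabs_le; split.
  - generalize (Cmod_triangle (u n) (l - u n)).
    replace (l - u n) with (- (u n - l)) by ring. rewrite Cmod_opp.
    replace (u n + - (u n - l)) with l by ring. lra.
  - generalize (Cmod_triangle l (u n - l)).
    replace (l + (u n - l)) with (u n) by ring. lra.
Qed.

Lemma is_Clim_mult (u v : nat -> C) (l m : C) :
  is_Clim u l -> is_Clim v m -> is_Clim (fun n => u n * v n) (l * m).
Proof.
  intros Hu Hv.
  apply is_Clim_squeeze with
    (fun n => Cmod (u n - l) * Cmod (v n) + Cmod l * Cmod (v n - m))%R.
  - intros n. rewrite <- !Cmod_mult.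
    replace (u n * v n - l * m) with ((u n - l) * v n + l * (v n - m)) by ring.
    apply Cmod_triangle.
  - replace (Finite 0) with (Finite (0 * Cmod m + Cmod l * 0)) by (f_equal; ring).
    apply is_lim_seq_plus'.
    + apply is_lim_seq_mult'; [exact Hu|]. now apply is_Clim_Cmod.
    + apply is_lim_seq_mult'; [apply is_lim_seq_const|exact Hv].
Qed.

Lemma is_Clim_incr (u : nat -> C) (k : nat) (l : C) :
  is_Clim u l <-> is_Clim (fun n => u (n + k)%nat) l.
Proof.
  apply (is_lim_seq_incr_n (fun n => Cmod (u n - l)) k).
Qed.

Lemma is_Clim_Cmod_le (u : nat -> C) (l : C) (M : R) :
  is_Clim u l -> (forall n, Cmod (u n) <= M)%R -> (Cmod l <= M)%R.
Proof.
  intros H HM.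
  apply (is_lim_seq_le (fun n => Cmod (u n)) (fun _ => M) (Cmod l) M); auto.
  - now apply is_Clim_Cmod.
  - apply is_lim_seq_const.
Qed.

Lemma is_Clim_Cmod_ge (u : nat -> C) (l : C) (M : R) :
  is_Clim u l -> (forall n, M <= Cmod (u n))%R -> (M <= Cmod l)%R.
Proof.
  intros H HM.
  apply (is_lim_seq_le (fun _ => M) (fun n => Cmod (u n)) M (Cmod l)); auto.
  - apply is_lim_seq_const.
  - now apply is_Clim_Cmod.
Qed.

(** Bridge from the filter convergence behind [ex_series], and hence [ex_Cseries], to limits in
    modulus. *)
Lemma filterlim_is_Clim (u : nat -> C) (l : C) :
  filterlim u eventually (@locally C_NormedModule l) -> is_Clim u l.
Proof.
  intros H. apply is_lim_seq_spec. intros eps.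
  apply (@filterlim_locally_ball_norm C_AbsRing nat C_NormedModule) with (eps := eps) in H;
    [|apply eventually_filter].
  destruct H as [N H]. exists N. intros n Hn.
  rewrite Rminus_0_r, Rabs_pos_eq by apply Cmod_ge_0.
  exact (H n Hn).
Qed.

(** * Complex series, absolute summability and dominated convergence *)

Definition is_Cseries (a : nat -> C) (l : C) : Prop := is_Clim (sum_n a) l.

Definition Cabs_summable (a : nat -> C) : Prop := ex_series (fun n => Cmod (a n)).

Lemma is_Cseries_CSeries (a : nat -> C) (l : C) : is_Cseries a l -> CSeries a = l.
Proof.
  apply is_Clim_CLim.
Qed.

Lemma Cabs_summable_ex (a : nat -> C) : Cabs_summable a -> ex_Cseries a.
Proof.
  intros H. apply (@ex_series_le C_AbsRing C_CompleteNormedModule a) with (2 := H).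
  intros n. apply Rle_refl.
Qed.

Lemma CSeries_correct (a : nat -> C) : Cabs_summable a -> is_Cseries a (CSeries a).
Proof.
  intros H. destruct (Cabs_summable_ex a H) as [l Hl].
  apply filterlim_is_Clim in Hl. now rewrite (is_Cseries_CSeries _ _ Hl).
Qed.

Lemma Csum_S (a : nat -> C) (n : nat) : sum_n a (S n) = sum_n a n + a (S n).
Proof.
  exact (sum_Sn a n).
Qed.

Lemma Csum_0 (a : nat -> C) : sum_n a 0 = a 0%nat.
Proof.
  exact (sum_O a).
Qed.

Lemma Rsum_S (a : nat -> R) (n : nat) : sum_n a (S n) = (sum_n a n + a (S n))%R.
Proof.
  exact (sum_Sn a n).
Qed.

Lemma Rsum_0 (a : nat -> R) : sum_n a 0 = a 0%nat.
Proof.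
  exact (sum_O a).
Qed.

Lemma Csum_ext (a b : nat -> C) (n : nat) :
  (forall k, a k = b k) -> sum_n a n = sum_n b n.
Proof.
  apply sum_n_ext.
Qed.

Lemma Csum_plus (a b : nat -> C) (n : nat) :
  sum_n (fun k => a k + b k) n = sum_n a n + sum_n b n.
Proof.
  exact (sum_n_plus a b n).
Qed.

Lemma Csum_scal (c : C) (a : nat -> C) (n : nat) :
  sum_n (fun k => c * a k) n = c * sum_n a n.
Proof.
  exact (sum_n_mult_l (K := C_Ring) c a n).
Qed.

Lemma Rsum_scal (c : R) (a : nat -> R) (n : nat) :
  sum_n (fun k => c * a k)%R n = (c * sum_n a n)%R.
Proof.
  exact (sum_n_mult_l (K := R_Ring) c a n).
Qed.

Lemma Csum_Cmod_le (a : nat -> C) (n : nat) :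
  (Cmod (sum_n a n) <= sum_n (fun k => Cmod (a k)) n)%R.
Proof.
  induction n as [|n IH].
  - rewrite Csum_0, Rsum_0. apply Rle_refl.
  - rewrite Csum_S, Rsum_S. eapply Rle_trans; [apply Cmod_triangle|]. lra.
Qed.

Lemma Rsum_le (a b : nat -> R) (n : nat) :
  (forall k, a k <= b k)%R -> (sum_n a n <= sum_n b n)%R.
Proof.
  intros H. induction n as [|n IH].
  - rewrite !Rsum_0. apply H.
  - rewrite !Rsum_S. specialize (H (S n)). lra.
Qed.

Lemma Rsum_le_Series (a : nat -> R) (n : nat) :
  (forall k, 0 <= a k)%R -> ex_series a -> (sum_n a n <= Series a)%R.
Proof.
  intros H0 H. apply Series_correct in H.
  apply (is_lim_seq_incr_compare (sum_n a) (Series a)); [exact H|].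
  intros k. rewrite Rsum_S. specialize (H0 (S k)). lra.
Qed.

Lemma ex_series_bounded (a : nat -> R) (M : R) :
  (forall k, 0 <= a k)%R -> (forall n, sum_n a n <= M)%R -> ex_series a.
Proof.
  intros H0 HM. destruct (ex_finite_lim_seq_incr (sum_n a) M) as [l Hl]; auto.
  - intros k. rewrite Rsum_S. specialize (H0 (S k)). lra.
  - now exists l.
Qed.

Lemma ex_series_le_scal (a b : nat -> R) (M : R) :
  (forall n, 0 <= a n <= M * b n)%R -> ex_series b -> ex_series a.
Proof.
  intros H Hb.
  apply (@ex_series_le R_AbsRing R_CompleteNormedModule a (fun n => M * b n)%R).
  - intros n. change (Rabs (a n) <= M * b n)%R.
    destruct (H n). now rewrite Rabs_pos_eq.
  - exact (ex_series_scal_l (K := R_AbsRing) M b Hb).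
Qed.

Lemma Series_nonneg (a : nat -> R) : (forall n, 0 <= a n)%R -> ex_series a -> (0 <= Series a)%R.
Proof.
  intros H Ha. apply Rle_trans with (sum_n a 0); [rewrite Rsum_0; apply H|].
  now apply Rsum_le_Series.
Qed.

Lemma CSeries_Cmod_le (a : nat -> C) :
  Cabs_summable a -> (Cmod (CSeries a) <= Series (fun n => Cmod (a n)))%R.
Proof.
  intros H. apply is_Clim_Cmod_le with (1 := CSeries_correct a H). intros n.
  eapply Rle_trans; [apply Csum_Cmod_le|].
  apply Rsum_le_Series; auto. intros; apply Cmod_ge_0.
Qed.

(** Each block of terms of [a] after index [N] is dominated by the same block of [b], hence by the
    tail of [b], and the bound passes to the limit. It depends on [b] alone, so it is uniform over
    any family of series with a common majorant. *)
Lemma CSeries_tail_le (a : nat -> C) (b : nat -> R) (N : nat) :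
  (forall n, Cmod (a n) <= b n)%R -> ex_series b ->
  (Cmod (sum_n a N - CSeries a) <= Series b - sum_n b N)%R.
Proof.
  intros Hab Hb.
  assert (Ha : Cabs_summable a).
  { apply ex_series_le_scal with b 1%R; auto.
    intros n. rewrite Rmult_1_l. split; auto using Cmod_ge_0. }
  assert (Hb0 : forall n, (0 <= b n)%R).
  { intros n. eapply Rle_trans; [apply Cmod_ge_0|apply Hab]. }
  replace (sum_n a N - CSeries a) with (- (CSeries a + - sum_n a N)) by ring.
  rewrite Cmod_opp.
  apply is_Clim_Cmod_le with (fun n => sum_n a (n + N) + - sum_n a N).
  - apply is_Clim_plus; [|apply is_Clim_const].
    apply -> (is_Clim_incr (sum_n a) N). now apply CSeries_correct.
  - intros n. apply Rle_trans with (sum_n b (n + N) - sum_n b N)%R.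
    + induction n as [|n IH]; cbn [plus Nat.add].
      * replace (sum_n a N + - sum_n a N) with (RtoC 0) by ring. rewrite Cmod_0. lra.
      * rewrite Csum_S, Rsum_S.
        replace (sum_n a (n + N) + a (S (n + N)) + - sum_n a N)
          with ((sum_n a (n + N) + - sum_n a N) + a (S (n + N))) by ring.
        eapply Rle_trans; [apply Cmod_triangle|]. specialize (Hab (S (n + N))). lra.
    + generalize (Rsum_le_Series b (n + N) Hb0 Hb). lra.
Qed.

Lemma is_Cseries_ext (a b : nat -> C) (l : C) :
  (forall n, a n = b n) -> is_Cseries a l -> is_Cseries b l.
Proof.
  intros E. apply is_Clim_ext. intros n. now apply sum_n_ext.
Qed.

Lemma is_Cseries_plus (a b : nat -> C) (l m : C) :
  is_Cseries a l -> is_Cseries b m -> is_Cseries (fun n => a n + b n) (l + m).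
Proof.
  intros Ha Hb. apply is_Clim_ext with (fun n => sum_n a n + sum_n b n).
  - intros n. now rewrite Csum_plus.
  - now apply is_Clim_plus.
Qed.

Lemma is_Cseries_scal (c : C) (a : nat -> C) (l : C) :
  is_Cseries a l -> is_Cseries (fun n => c * a n) (c * l).
Proof.
  intros Ha. apply is_Clim_ext with (fun n => c * sum_n a n).
  - intros n. now rewrite Csum_scal.
  - apply is_Clim_mult; auto using is_Clim_const.
Qed.

Lemma is_Cseries_sum (a : nat -> nat -> C) (l : nat -> C) (N : nat) :
  (forall n, is_Cseries (a n) (l n)) ->
  is_Cseries (fun s => sum_n (fun n => a n s) N) (sum_n l N).
Proof.
  intros H. induction N as [|N IH].
  - rewrite Csum_0. apply is_Cseries_ext with (2 := H 0%nat).
    intros s. now rewrite Csum_0.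
  - rewrite Csum_S. apply is_Cseries_ext with (2 := is_Cseries_plus _ _ _ _ IH (H (S N))).
    intros s. now rewrite Csum_S.
Qed.

Lemma is_Cseries_shift (a : nat -> C) (l : C) :
  a 0%nat = 0 -> is_Cseries a l -> is_Cseries (fun n => a (S n)) l.
Proof.
  intros H0 H. apply (is_Clim_incr (sum_n a) 1) in H.
  apply is_Clim_ext with (2 := H). intros n. rewrite Nat.add_1_r.
  induction n as [|n IH].
  - rewrite Csum_S, !Csum_0, H0. ring.
  - now rewrite (Csum_S a), IH, (Csum_S (fun k => a (S k))).
Qed.

Lemma Cabs_summable_mult_bounded (u f : nat -> C) (M : R) :
  Cabs_summable u -> (forall s, Cmod (f s) <= M)%R -> Cabs_summable (fun s => u s * f s).
Proof.
  intros Hu Hf. apply ex_series_le_scal with (fun s => Cmod (u s)) M; [|exact Hu].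
  intros s. split; [apply Cmod_ge_0|]. rewrite Cmod_mult, Rmult_comm.
  apply Rmult_le_compat_r; auto using Cmod_ge_0.
Qed.

(** A form of Tannery's theorem: with summable weights [u] and factors converging uniformly in [s]
    at rate [e N], the error is at most [e N] times the sum of the [Cmod (u s)]. The bound [G] makes
    the limiting series summable. *)
Lemma is_Clim_CSeries (u : nat -> C) (g : nat -> nat -> C) (h : nat -> C)
  (F : nat -> C) (e : nat -> R) (G : R) :
  Cabs_summable u -> (forall s, Cmod (h s) <= G)%R ->
  (forall N s, Cmod (g N s - h s) <= e N)%R -> is_lim_seq e 0 ->
  (forall N, is_Cseries (fun s => u s * g N s) (F N)) ->
  is_Clim F (CSeries (fun s => u s * h s)).
Proof.
  intros Hu Hh Hg He HF.
  apply is_Clim_squeeze with (fun N => e N * Series (fun s => Cmod (u s)))%R.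
  - intros N.
    assert (D := Cabs_summable_mult_bounded u _ _ Hu (Hg N)).
    replace (F N - CSeries (fun s => u s * h s))
      with (CSeries (fun s => u s * (g N s - h s))).
    + eapply Rle_trans; [apply CSeries_Cmod_le, D|].
      rewrite <- Series_scal_l. apply Series_le.
      * intros s. split; [apply Cmod_ge_0|]. rewrite Cmod_mult, Rmult_comm.
        apply Rmult_le_compat_r; auto using Cmod_ge_0.
      * exact (ex_series_scal_l (K := R_AbsRing) _ _ Hu).
    + apply is_Cseries_CSeries.
      replace (F N - CSeries (fun s => u s * h s))
        with (F N + (-1) * CSeries (fun s => u s * h s)) by ring.
      eapply is_Cseries_ext;
        [|apply is_Cseries_plus; [apply HF|apply is_Cseries_scal, CSeries_correct, (Cabs_summable_mult_bounded u h G Hu Hh)]].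
      intros s. simpl. ring.
  - replace (Finite 0) with (Finite (0 * Series (fun s => Cmod (u s)))) by (f_equal; ring).
    apply is_lim_seq_mult'; [exact He|apply is_lim_seq_const].
Qed.

(** * Algebra of q-shifted factorials and their zeros *)

Lemma qpoch_add (a q : C) (n m : nat) :
  qpoch a q (n + m) = qpoch a q n * qpoch (a * q ^ n) q m.
Proof.
  induction m as [|m IH].
  - rewrite Nat.add_0_r. simpl. ring.
  - rewrite Nat.add_succ_r. cbn [qpoch]. rewrite IH, Cpow_add_r. ring.
Qed.

Lemma qpoch_0_l (q : C) (n : nat) : qpoch 0 q n = 1.
Proof.
  induction n as [|n IH]; cbn [qpoch]; [reflexivity|]. rewrite IH. ring.
Qed.

Lemma qpoch_inf_0_l (q : C) : qpoch_inf 0 q = 1.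
Proof.
  apply is_Clim_CLim. apply is_Clim_ext with (fun _ => RtoC 1).
  - intros n. now rewrite qpoch_0_l.
  - apply is_Clim_const.
Qed.

Lemma not_qpole_factor (a q : C) (n : nat) :
  q <> 0 -> not_qpole a q -> 1 - a * q ^ n <> 0.
Proof.
  intros Hq Ha E. apply (Ha n).
  assert (Hn := Cpow_nz q n Hq).
  replace a with (a * q ^ n * / q ^ n) by (field; exact Hn).
  replace (a * q ^ n) with (1 - (1 - a * q ^ n)) by ring.
  rewrite E. field. exact Hn.
Qed.

Lemma qpoch_neq_0 (a q : C) (n : nat) : q <> 0 -> not_qpole a q -> qpoch a q n <> 0.
Proof.
  intros Hq Ha. induction n as [|n IH]; cbn [qpoch]; [exact C1_nz|].
  apply Cmult_neq_0; auto. now apply not_qpole_factor.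
Qed.

Lemma qpoch_pole (a q : C) (m n : nat) : a * q ^ m = 1 -> (m < n)%nat -> qpoch a q n = 0.
Proof.
  intros E. induction n as [|n IH]; [lia|]. intros H. cbn [qpoch].
  destruct (Nat.eq_dec m n) as [->|Hmn].
  - rewrite E. ring.
  - rewrite IH by lia. ring.
Qed.

Lemma not_qpole_shift (a q : C) (n : nat) :
  q <> 0 -> not_qpole a q -> not_qpole (a * q ^ n) q.
Proof.
  intros Hq Ha m E. apply (not_qpole_factor a q (n + m) Hq Ha).
  rewrite Cpow_add_r, Cmult_assoc, E. field. now apply Cpow_nz.
Qed.

Lemma Cmod_1_minus_le (z : C) : (Cmod (1 - z) <= 1 + Cmod z)%R.
Proof.
  generalize (Cmod_triangle 1 (- z)). now rewrite Cmod_opp, Cmod_1.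
Qed.

Lemma Cmod_1_minus_ge (z : C) : (1 - Cmod z <= Cmod (1 - z))%R.
Proof.
  generalize (Cmod_triangle (1 - z) z).
  replace (1 - z + z) with (RtoC 1) by ring. rewrite Cmod_1. lra.
Qed.

Lemma exp_le_compat (s t : R) : (s <= t)%R -> (exp s <= exp t)%R.
Proof.
  intros [H| ->]; [now apply Rlt_le, exp_increasing|apply Rle_refl].
Qed.

(** * Uniform bounds on q-shifted factorials and the infinite product *)

Section Convergence.

Variable q : C.
Hypotheses (hq0 : (0 < Cmod q)%R) (hq1 : (Cmod q < 1)%R).

Let r := Cmod q.

Lemma q_neq_0 : q <> 0.
Proof.
  now apply Cmod_gt_0.
Qed.

Lemma not_qpole_lt1 (a : C) : (Cmod a < 1)%R -> not_qpole a q.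
Proof.
  intros Ha m E. assert (Hm := Cpow_nz q m q_neq_0).
  assert (H1 : Cmod (a * q ^ m) = 1%R).
  { rewrite E, Cinv_l by exact Hm. apply Cmod_1. }
  rewrite Cmod_mult, Cmod_pow in H1.
  assert (Cmod q ^ m <= 1)%R.
  { rewrite <- (pow1 m). apply pow_incr. lra. }
  assert (0 < Cmod q ^ m)%R by now apply pow_lt.
  assert (0 <= Cmod a)%R by apply Cmod_ge_0. nra.
Qed.

(** The quotient is the geometric sum 1 + r + ... + r^(n-1) in closed form; it is the exponent or
    the deficit carried by the product estimates below. *)
Lemma geom_pow_range (n : nat) : (0 <= (1 - r ^ n) / (1 - r) <= / (1 - r))%R.
Proof.
  assert (0 < r ^ n)%R by now apply pow_lt.
  assert (r ^ n <= 1)%R by (rewrite <- (pow1 n); apply pow_incr; unfold r; lra).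
  assert (0 < / (1 - r))%R by (apply Rinv_0_lt_compat; unfold r; lra).
  unfold Rdiv. split; nra.
Qed.

Lemma geom_pow_step (n : nat) :
  ((1 - r ^ S n) / (1 - r) = (1 - r ^ n) / (1 - r) + r ^ n)%R.
Proof.
  simpl. field. unfold r. lra.
Qed.

(** Each factor satisfies |1 - a q^j| <= 1 + |a| r^j <= exp(|a| r^j), and the exponents add up to at
    most |a| / (1 - r), whatever [n] is. *)
Lemma qpoch_le_exp (a : C) (n : nat) :
  (Cmod (qpoch a q n) <= exp (Cmod a * / (1 - r)))%R.
Proof.
  apply Rle_trans with (exp (Cmod a * ((1 - r ^ n) / (1 - r)))).
  - induction n as [|n IH].
    + cbn [qpoch]. rewrite Cmod_1. simpl.
      replace (Cmod a * ((1 - 1) / (1 - r)))%R with 0%R by (field; unfold r; lra).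
      rewrite exp_0. lra.
    + cbn [qpoch]. rewrite geom_pow_step, Rmult_plus_distr_l, exp_plus, Cmod_mult.
      apply Rmult_le_compat; auto using Cmod_ge_0.
      eapply Rle_trans; [apply Cmod_1_minus_le|].
      rewrite Cmod_mult, Cmod_pow. apply exp_ineq1_le.
  - apply exp_le_compat. apply Rmult_le_compat_l; [apply Cmod_ge_0|]. apply geom_pow_range.
Qed.

(** Weierstrass product inequality: a product of factors 1 - t_j is at least 1 minus the sum of the
    t_j, here with t_j = |a| r^j of total at most 1/2. *)
Lemma qpoch_ge_half (a : C) (n : nat) :
  (Cmod a * / (1 - r) <= / 2)%R -> (/ 2 <= Cmod (qpoch a q n))%R.
Proof.
  intros Ha. assert (Ha0 := Cmod_ge_0 a).
  (* The constant 1/2 is not preserved by multiplying in one more factor, so the induction carries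
     the sharper bound with the partial geometric sum. *)
  apply Rle_trans with (1 - Cmod a * ((1 - r ^ n) / (1 - r)))%R.
  { destruct (geom_pow_range n). nra. }
  induction n as [|n IH].
  - cbn [qpoch]. rewrite Cmod_1. simpl.
    replace (Cmod a * ((1 - 1) / (1 - r)))%R with 0%R by (field; unfold r; lra). lra.
  - cbn [qpoch]. rewrite geom_pow_step, Cmod_mult.
    assert (H := Cmod_1_minus_ge (a * q ^ n)). rewrite Cmod_mult, Cmod_pow in H.
    fold r in H.
    assert (0 < r ^ n)%R by now apply pow_lt.
    assert (r ^ n <= 1)%R by (rewrite <- (pow1 n); apply pow_incr; unfold r; lra).
    assert (1 <= / (1 - r))%R.
    { rewrite <- Rinv_1. apply Rinv_le_contravar; unfold r; lra. }
    assert (Cmod a <= / 2)%R by nra.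
    assert (Cmod a * r ^ n <= / 2)%R by nra.
    destruct (geom_pow_range n).
    assert (Cmod a * ((1 - r ^ n) / (1 - r)) <= / 2)%R by nra.
    set (t := (Cmod a * ((1 - r ^ n) / (1 - r)))%R) in *.
    assert (0 <= t)%R by (apply Rmult_le_pos; assumption).
    assert (0 <= Cmod a * r ^ n)%R by (apply Rmult_le_pos; lra).
    rewrite Rmult_plus_distr_l. fold t.
    set (w := (Cmod a * r ^ n)%R) in *.
    (* Expanding the product leaves the extra term t w, which is nonnegative. *)
    apply Rle_trans with ((1 - t) * (1 - w))%R; [nra|].
    apply Rmult_le_compat; lra.
Qed.

(** Beyond some index [N] the shifted parameter [a * q ^ N] is small enough for the bound 1/2, and
    the first [N] factors do not vanish. *)
Lemma qpoch_bounded_below (a : C) :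
  not_qpole a q -> exists c : R, (0 < c)%R /\ forall n, (c <= Cmod (qpoch a q n))%R.
Proof.
  intros Ha.
  assert (HN : exists N, (Cmod (a * q ^ N) * / (1 - r) <= / 2)%R).
  { assert (L : is_lim_seq (fun n => Cmod a * / (1 - r) * r ^ n)%R 0).
    { replace (Finite 0) with (Finite (Cmod a * / (1 - r) * 0)) by (f_equal; ring).
      apply is_lim_seq_mult'; [apply is_lim_seq_const|].
      apply is_lim_seq_geom. unfold r. rewrite Rabs_pos_eq; lra. }
    apply is_lim_seq_spec in L.
    destruct (L (mkposreal (/ 2) ltac:(lra))) as [N HN]. exists N.
    specialize (HN N (le_n N)). simpl in HN. apply Rabs_def2 in HN.
    rewrite Cmod_mult, Cmod_pow. fold r. lra. }
  destruct HN as [N HN].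
  set (M := exp (Cmod a * / (1 - r))).
  assert (HM : (0 < M)%R) by apply exp_pos.
  assert (Hp : (0 < Cmod (qpoch a q N))%R).
  { apply Cmod_gt_0. apply qpoch_neq_0; auto using q_neq_0. }
  exists (Cmod (qpoch a q N) * / 2 / M)%R. split.
  { apply Rdiv_lt_0_compat; lra. }
  intros n. apply (Rmult_le_reg_r M); [exact HM|].
  unfold Rdiv. rewrite Rmult_assoc, Rinv_l, Rmult_1_r by lra.
  apply Rle_trans with (Cmod (qpoch a q (N + n))).
  - rewrite qpoch_add, Cmod_mult. apply Rmult_le_compat_l; [lra|]. now apply qpoch_ge_half.
  - rewrite Nat.add_comm, qpoch_add, Cmod_mult.
    apply Rmult_le_compat_l; [apply Cmod_ge_0|].
    eapply Rle_trans; [apply qpoch_le_exp|].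
    apply exp_le_compat. apply Rmult_le_compat_r.
    + apply Rlt_le, Rinv_0_lt_compat. unfold r; lra.
    + rewrite Cmod_mult, Cmod_pow. rewrite <- (Rmult_1_r (Cmod a)) at 2.
      apply Rmult_le_compat_l; [apply Cmod_ge_0|].
      rewrite <- (pow1 n). apply pow_incr. lra.
Qed.

Lemma ex_series_geom_q : ex_series (fun n => r ^ n)%R.
Proof.
  apply ex_series_geom. unfold r. rewrite Rabs_pos_eq; lra.
Qed.

Lemma is_Clim_qpoch (a : C) : is_Clim (qpoch a q) (qpoch_inf a q).
Proof.
  set (d := fun n => qpoch a q (S n) - qpoch a q n).
  assert (Hd : Cabs_summable d).
  { apply ex_series_le_scal with (fun n => r ^ n)%R (exp (Cmod a * / (1 - r)) * Cmod a)%R;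
      [|apply ex_series_geom_q].
    intros n. split; [apply Cmod_ge_0|]. unfold d. cbn [qpoch].
    replace (qpoch a q n * (1 - a * q ^ n) - qpoch a q n)
      with (- (qpoch a q n * (a * q ^ n))) by ring.
    rewrite Cmod_opp, !Cmod_mult, Cmod_pow. fold r. rewrite Rmult_assoc.
    apply Rmult_le_compat_r; [|apply qpoch_le_exp].
    apply Rmult_le_pos; [apply Cmod_ge_0|]. apply pow_le, Cmod_ge_0. }
  assert (H : is_Clim (qpoch a q) (CSeries d + 1)).
  { apply (is_Clim_incr (qpoch a q) 1).
    apply is_Clim_ext with (fun n => sum_n d n + 1).
    - intros n. rewrite Nat.add_1_r. induction n as [|n IH].
      + rewrite Csum_0. unfold d. cbn [qpoch]. ring.
      + rewrite Csum_S. replace (sum_n d n + d (S n) + 1)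
          with ((sum_n d n + 1) + d (S n)) by ring.
        rewrite IH. unfold d. ring.
    - apply is_Clim_plus; [now apply CSeries_correct|apply is_Clim_const]. }
  unfold qpoch_inf. now rewrite (is_Clim_CLim _ _ H).
Qed.

Lemma qpoch_inf_neq_0 (a : C) : not_qpole a q -> qpoch_inf a q <> 0.
Proof.
  intros Ha. destruct (qpoch_bounded_below a Ha) as (c & Hc & H).
  apply Cmod_gt_0. apply Rlt_le_trans with c; [exact Hc|].
  now apply is_Clim_Cmod_ge with (qpoch a q); [apply is_Clim_qpoch|].
Qed.

Lemma qpoch_inf_split (a : C) (n : nat) :
  qpoch_inf a q = qpoch a q n * qpoch_inf (a * q ^ n) q.
Proof.
  apply is_Clim_unique with (fun m => qpoch a q (m + n)).
  - apply -> (is_Clim_incr (qpoch a q) n). apply is_Clim_qpoch.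
  - apply is_Clim_ext with (fun m => qpoch a q n * qpoch (a * q ^ n) q m).
    + intros m. now rewrite Nat.add_comm, qpoch_add.
    + apply is_Clim_mult; [apply is_Clim_const|apply is_Clim_qpoch].
Qed.

Definition qbin_term (a z : C) (s : nat) : C := qpoch a q s / qpoch q q s * z ^ s.

Lemma qpoch_q_neq_0 (n : nat) : qpoch q q n <> 0.
Proof.
  apply qpoch_neq_0; [exact q_neq_0|]. now apply not_qpole_lt1.
Qed.

Lemma qbin_term_mult (a z w : C) (s : nat) :
  qbin_term a (z * w) s = qbin_term a z s * w ^ s.
Proof.
  unfold qbin_term. rewrite Cpow_mult_l. ring.
Qed.

Lemma Cmod_qpow_le_1 (n s : nat) : (Cmod ((q ^ n) ^ s) <= 1)%R.
Proof.
  rewrite <- Cpow_mult_r, Cmod_pow. rewrite <- (pow1 (n * s)). apply pow_incr. lra.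
Qed.

Lemma Cabs_summable_qbin_shift (a z : C) (n : nat) :
  Cabs_summable (qbin_term a z) -> Cabs_summable (qbin_term a (z * q ^ n)).
Proof.
  intros H. apply ex_series_le_scal with (fun s => Cmod (qbin_term a z s)) 1%R; [|exact H].
  intros s. split; [apply Cmod_ge_0|].
  rewrite qbin_term_mult, Cmod_mult, Rmult_comm.
  apply Rmult_le_compat_r; [apply Cmod_ge_0|apply Cmod_qpow_le_1].
Qed.

Lemma qbin_functional_equation (a z : C) :
  Cabs_summable (qbin_term a z) ->
  (1 - z) * CSeries (qbin_term a z) = (1 - a * z) * CSeries (qbin_term a (z * q)).
Proof.
  intros H.
  set (l := CSeries (qbin_term a z)). set (l' := CSeries (qbin_term a (z * q))).
  assert (Hl : is_Cseries (qbin_term a z) l) by now apply CSeries_correct.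
  assert (Hl' : is_Cseries (qbin_term a (z * q)) l').
  { apply CSeries_correct. rewrite <- (Cpow_1_r q). now apply Cabs_summable_qbin_shift. }
  assert (E : l + (-1) * l' = z * (l + (- a) * l')).
  { apply is_Clim_unique with (sum_n (fun s => z * (qbin_term a z s + (- a) * qbin_term a (z * q) s))).
    - apply is_Cseries_ext with
        (fun s => qbin_term a z (S s) + (-1) * qbin_term a (z * q) (S s)).
      + intros s. rewrite !qbin_term_mult. unfold qbin_term. cbn [qpoch].
        rewrite !Cpow_S. field. split; [apply qpoch_q_neq_0|].
        intros E. apply (qpoch_q_neq_0 (S s)). cbn [qpoch]. rewrite E. ring.
      + apply (is_Cseries_shift (fun s => qbin_term a z s + (-1) * qbin_term a (z * q) s)).
        * unfold qbin_term. simpl. field.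
        * apply is_Cseries_plus; [exact Hl|]. now apply is_Cseries_scal.
    - apply is_Cseries_scal, is_Cseries_plus; [exact Hl|]. now apply is_Cseries_scal. }
  replace ((1 - z) * l) with (l + (-1) * l' + l' - z * l) by ring. rewrite E. ring.
Qed.

Lemma q_binomial (a z : C) :
  Cabs_summable (qbin_term a z) ->
  qpoch_inf z q * CSeries (qbin_term a z) = qpoch_inf (a * z) q.
Proof.
  intros H.
  assert (I : forall n, qpoch z q n * CSeries (qbin_term a z)
    = qpoch (a * z) q n * CSeries (qbin_term a (z * q ^ n))).
  { induction n as [|n IH].
    - simpl. now rewrite !Cmult_1_l, Cmult_1_r.
    - cbn [qpoch].
      replace (qpoch z q n * (1 - z * q ^ n) * CSeries (qbin_term a z))
        with ((1 - z * q ^ n) * (qpoch z q n * CSeries (qbin_term a z))) by ring.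
      rewrite IH.
      assert (F := qbin_functional_equation a (z * q ^ n)
                     (Cabs_summable_qbin_shift a z n H)).
      replace (z * q ^ n * q) with (z * q ^ S n) in F by (rewrite Cpow_S; ring).
      replace ((1 - z * q ^ n) * (qpoch (a * z) q n * CSeries (qbin_term a (z * q ^ n))))
        with (qpoch (a * z) q n * ((1 - z * q ^ n) * CSeries (qbin_term a (z * q ^ n))))
        by ring.
      rewrite F. ring. }
  set (h := fun s : nat => match s with O => RtoC 1 | _ => RtoC 0 end).
  assert (L1 : is_Clim (fun n => CSeries (qbin_term a (z * q ^ n))) 1).
  { replace (RtoC 1) with (CSeries (fun s => qbin_term a z s * h s)).
    - apply is_Clim_CSeries with (fun N s => (q ^ N) ^ s) (fun N => r ^ N)%R 1%R.
      + exact H.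
      + intros [|s]; cbn [h]; rewrite ?Cmod_1, ?Cmod_0; lra.
      + intros N [|s]; cbn [h].
        * replace ((q ^ N) ^ 0 - 1) with (RtoC 0) by (simpl; ring).
          rewrite Cmod_0. apply pow_le, Cmod_ge_0.
        * rewrite Cpow_S. replace (q ^ N * (q ^ N) ^ s - 0) with (q ^ N * (q ^ N) ^ s) by ring.
          rewrite Cmod_mult, Cmod_pow. fold r.
          assert (0 <= r ^ N)%R by apply pow_le, Cmod_ge_0.
          assert (Cmod ((q ^ N) ^ s) <= 1)%R by apply Cmod_qpow_le_1. nra.
      + apply is_lim_seq_geom. unfold r. rewrite Rabs_pos_eq; lra.
      + intros N. eapply is_Cseries_ext;
          [|apply CSeries_correct, Cabs_summable_qbin_shift, H].
        intros s. apply qbin_term_mult.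
    - apply is_Cseries_CSeries. apply is_Clim_ext with (fun _ => RtoC 1);
        [|apply is_Clim_const].
      intros n. induction n as [|n IH].
      + rewrite Csum_0. unfold qbin_term. simpl. field.
      + rewrite Csum_S, <- IH. cbn [h]. ring. }
  apply is_Clim_unique with (fun n => qpoch z q n * CSeries (qbin_term a z)).
  - apply is_Clim_mult; [apply is_Clim_qpoch|apply is_Clim_const].
  - apply is_Clim_ext with (1 := fun n => eq_sym (I n)).
    replace (qpoch_inf (a * z) q) with (qpoch_inf (a * z) q * 1) by ring.
    apply is_Clim_mult; [apply is_Clim_qpoch|exact L1].
Qed.

Lemma qpoch_ratio_bounded (a c : C) :
  not_qpole c q -> exists M : R, forall n, (Cmod (qpoch a q n / qpoch c q n) <= M)%R.
Proof.
  intros Hc. destruct (qpoch_bounded_below c Hc) as (k & Hk & H).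
  exists (exp (Cmod a * / (1 - r)) * / k)%R. intros n.
  rewrite Cmod_div by (apply qpoch_neq_0; auto using q_neq_0).
  apply Rmult_le_compat; [apply Cmod_ge_0| |apply qpoch_le_exp|].
  - apply Rlt_le, Rinv_0_lt_compat. eapply Rlt_le_trans; [exact Hk|apply H].
  - now apply Rinv_le_contravar.
Qed.

Lemma qpoch_ratio_bounded_below (a c : C) :
  not_qpole a q -> not_qpole c q ->
  exists k : R, (0 < k)%R /\ forall n, (k <= Cmod (qpoch a q n / qpoch c q n))%R.
Proof.
  intros Ha Hc. destruct (qpoch_bounded_below a Ha) as (k & Hk & H).
  exists (k * / exp (Cmod c * / (1 - r)))%R. split.
  { apply Rmult_lt_0_compat; [exact Hk|]. apply Rinv_0_lt_compat, exp_pos. }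
  intros n. assert (Hn : qpoch c q n <> 0) by (apply qpoch_neq_0; auto using q_neq_0).
  rewrite Cmod_div by exact Hn.
  apply Rmult_le_compat; [lra| |apply H|].
  - apply Rlt_le, Rinv_0_lt_compat, exp_pos.
  - apply Rinv_le_contravar; [now apply Cmod_gt_0|apply qpoch_le_exp].
Qed.

Lemma Cabs_summable_qbin (a z : C) : (Cmod z < 1)%R -> Cabs_summable (qbin_term a z).
Proof.
  intros Hz. destruct (qpoch_ratio_bounded a q (not_qpole_lt1 q hq1)) as [M HM].
  apply ex_series_le_scal with (fun s => Cmod z ^ s)%R M.
  - intros s. split; [apply Cmod_ge_0|]. unfold qbin_term.
    rewrite Cmod_mult, Cmod_pow. apply Rmult_le_compat_r; [|apply HM].
    apply pow_le, Cmod_ge_0.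
  - apply ex_series_geom. now rewrite Rabs_pos_eq by apply Cmod_ge_0.
Qed.

Lemma Phi1_term_qbin (a b c x y : C) (n k : nat) :
  not_qpole c q ->
  Phi1_term a b c q x y n k
  = qpoch a q (n + k) / qpoch c q (n + k) * (qbin_term b x n * qbin_term 0 y k).
Proof.
  intros Hc. unfold Phi1_term, qbin_term. rewrite qpoch_0_l. field.
  repeat split; auto using qpoch_q_neq_0. apply qpoch_neq_0; auto using q_neq_0.
Qed.

Lemma ex_CDseries_Phi1 (a b c x y : C) :
  not_qpole c q -> (Cmod x < 1)%R -> (Cmod y < 1)%R ->
  ex_CDseries (Phi1_term a b c q x y).
Proof.
  intros Hc Hx Hy. destruct (qpoch_ratio_bounded a c Hc) as [M HM].
  assert (HM0 : (0 <= M)%R) by (eapply Rle_trans; [apply Cmod_ge_0|apply (HM 0%nat)]).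
  assert (Sx := Cabs_summable_qbin b x Hx). assert (Sy := Cabs_summable_qbin 0 y Hy).
  set (V := Series (fun n => Cmod (qbin_term b x n))).
  set (W := Series (fun n => Cmod (qbin_term 0 y n))).
  assert (HW : (0 <= W)%R) by (apply Series_nonneg; auto using Cmod_ge_0).
  exists (M * W * V)%R. intros N K.
  apply Rle_trans with (sum_n (fun n => M * W * Cmod (qbin_term b x n))%R N).
  - apply Rsum_le. intros n.
    apply Rle_trans with
      (sum_n (fun k => M * Cmod (qbin_term b x n) * Cmod (qbin_term 0 y k))%R K).
    + apply Rsum_le. intros k. rewrite Phi1_term_qbin, !Cmod_mult, Rmult_assoc by exact Hc.
      apply Rmult_le_compat_r; [|apply HM].
      apply Rmult_le_pos; apply Cmod_ge_0.
    + rewrite Rsum_scal.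
      replace (M * W * Cmod (qbin_term b x n))%R
        with (M * Cmod (qbin_term b x n) * W)%R by ring.
      apply Rmult_le_compat_l.
      * apply Rmult_le_pos; auto using Cmod_ge_0.
      * apply Rsum_le_Series; auto using Cmod_ge_0.
  - rewrite Rsum_scal. apply Rmult_le_compat_l.
    + now apply Rmult_le_pos.
    + apply Rsum_le_Series; auto using Cmod_ge_0.
Qed.

Lemma phi32_term_qbin (d x y e a : C) (s : nat) :
  not_qpole e q ->
  phi32_term d x y e 0 q a s
  = qbin_term d a s * (qpoch x q s * (qpoch y q s / qpoch e q s)).
Proof.
  intros He. unfold phi32_term, qbin_term. rewrite qpoch_0_l. field.
  split; auto using qpoch_q_neq_0. apply qpoch_neq_0; auto using q_neq_0.
Qed.

Lemma Cabs_summable_phi32 (d x y e a : C) :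
  not_qpole e q -> Cabs_summable (qbin_term d a) ->
  Cabs_summable (phi32_term d x y e 0 q a).
Proof.
  intros He H. destruct (qpoch_ratio_bounded y e He) as [M HM].
  apply ex_series_ext with (fun s => Cmod
    (qbin_term d a s * (qpoch x q s * (qpoch y q s / qpoch e q s)))).
  { intros s. now rewrite phi32_term_qbin. }
  apply (Cabs_summable_mult_bounded (qbin_term d a)) with (exp (Cmod x * / (1 - r)) * M)%R;
    [exact H|].
  intros s. rewrite Cmod_mult.
  apply Rmult_le_compat; auto using Cmod_ge_0, qpoch_le_exp.
Qed.

Lemma ex_Cseries_terms (a : nat -> C) :
  ex_Cseries a -> is_lim_seq (fun n => Cmod (a n)) 0.
Proof.
  intros [l Hl]. apply filterlim_is_Clim in Hl.
  apply is_lim_seq_incr_1. rewrite <- Cmod_0.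
  apply is_Clim_Cmod with (u := fun n => a (S n)).
  replace (RtoC 0) with (l + (-1) * l) by ring.
  apply is_Clim_ext with (fun n => sum_n a (n + 1) + (-1) * sum_n a n).
  - intros n. rewrite Nat.add_1_r, Csum_S. ring.
  - apply is_Clim_plus.
    + now apply -> (is_Clim_incr (sum_n a) 1).
    + apply is_Clim_mult; [apply is_Clim_const|exact Hl].
Qed.

Lemma Cmod_lt1_of_pow_lim (a : C) : is_lim_seq (fun n => Cmod a ^ n)%R 0 -> (Cmod a < 1)%R.
Proof.
  intros H. destruct (Rlt_le_dec (Cmod a) 1) as [Ha|Ha]; [exact Ha|].
  assert (H1 : Rbar_le 1 0).
  { apply (is_lim_seq_le (fun _ => 1%R) (fun n => Cmod a ^ n)%R); auto.
    - intros n. now apply pow_R1_Rle.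
    - apply is_lim_seq_const. }
  simpl in H1. lra.
Qed.

Lemma qbin_terms_null_cases (d a : C) :
  is_lim_seq (fun n => Cmod (qbin_term d a n)) 0 ->
  (Cmod a < 1)%R \/ exists m, d = / q ^ m.
Proof.
  intros H. destruct (classic (exists m, d = / q ^ m)) as [Hd|Hd]; [now right|left].
  assert (Hd' : not_qpole d q) by (intros m E; apply Hd; now exists m).
  destruct (qpoch_ratio_bounded_below d q Hd' (not_qpole_lt1 q hq1)) as (k & Hk & Hle).
  apply Cmod_lt1_of_pow_lim.
  apply is_lim_seq_squeeze0 with (fun n => / k * Cmod (qbin_term d a n))%R.
  - intros n. assert (Hn : (0 <= Cmod a ^ n)%R) by apply pow_le, Cmod_ge_0.
    split; [exact Hn|]. unfold qbin_term. rewrite Cmod_mult, Cmod_pow, <- Rmult_assoc.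
    rewrite <- (Rmult_1_l (Cmod a ^ n)) at 1. apply Rmult_le_compat_r; [exact Hn|].
    rewrite <- (Rinv_l k) by lra. apply Rmult_le_compat_l; [|apply Hle].
    now apply Rlt_le, Rinv_0_lt_compat.
  - replace (Finite 0) with (Finite (/ k * 0)) by (f_equal; ring).
    apply is_lim_seq_mult'; [apply is_lim_seq_const|exact H].
Qed.

Lemma Cabs_summable_qbin_terminating (a z : C) (m : nat) :
  a = / q ^ m -> Cabs_summable (qbin_term a z).
Proof.
  intros E. apply (ex_series_incr_n _ (S m)).
  apply ex_series_le_scal with (fun n => r ^ n)%R 0%R; [|apply ex_series_geom_q].
  intros n. unfold qbin_term. rewrite (qpoch_pole a q m (S m + n)); [|rewrite E|lia].
  - unfold Cdiv. rewrite !Cmult_0_l, Cmod_0, Rmult_0_l. lra.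
  - apply Cinv_l, Cpow_nz, q_neq_0.
Qed.

(* A convergent [3phi2] has [|a| < 1] or terminates; in both cases a pole
   [a = q^-m] is excluded, in the second because it would make [c = d a] a pole. *)
Lemma phi32_convergent (d a x y e : C) :
  not_qpole (d * a) q -> not_qpole x q -> not_qpole y q -> not_qpole e q ->
  ex_Cseries (phi32_term d x y e 0 q a) ->
  Cabs_summable (qbin_term d a) /\ not_qpole a q.
Proof.
  intros Hc Hx Hy He H. apply ex_Cseries_terms in H.
  destruct (qpoch_bounded_below x Hx) as (k & Hk & Hkx).
  destruct (qpoch_ratio_bounded_below y e Hy He) as (k' & Hk' & Hky).
  assert (L : is_lim_seq (fun n => Cmod (qbin_term d a n)) 0).
  { apply is_lim_seq_squeeze0 with (fun n => / (k * k') * Cmod (phi32_term d x y e 0 q a n))%R.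
    - intros n. split; [apply Cmod_ge_0|].
      rewrite phi32_term_qbin, !(Cmod_mult (qbin_term d a n)) by exact He.
      rewrite (Rmult_comm (Cmod (qbin_term d a n))), <- Rmult_assoc.
      rewrite <- (Rmult_1_l (Cmod (qbin_term d a n))) at 1.
      apply Rmult_le_compat_r; [apply Cmod_ge_0|].
      assert (Hkk : (0 < k * k')%R) by now apply Rmult_lt_0_compat.
      rewrite <- (Rinv_l (k * k')) by lra. apply Rmult_le_compat_l.
      + now apply Rlt_le, Rinv_0_lt_compat.
      + rewrite Cmod_mult. apply Rmult_le_compat; auto; lra.
    - replace (Finite 0) with (Finite (/ (k * k') * 0)) by (f_equal; ring).
      apply is_lim_seq_mult'; [apply is_lim_seq_const|exact H]. }
  destruct (qbin_terms_null_cases d a L) as [Ha|[m Hd]].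
  - split; [now apply Cabs_summable_qbin|now apply not_qpole_lt1].
  - split; [now apply Cabs_summable_qbin_terminating with m|].
    intros m' Ha. apply (Hc (m + m')%nat). rewrite Hd, Ha, Cpow_add_r. field.
    split; apply Cpow_nz, q_neq_0.
Qed.

Lemma Cabs_summable_of_weighted (f g : nat -> C) (k M : R) :
  (0 < k)%R -> (forall n, k <= Cmod (f n))%R ->
  (forall N, sum_n (fun n => Cmod (f n * g n)) N <= M)%R -> Cabs_summable g.
Proof.
  intros Hk Hf HM. apply ex_series_bounded with (/ k * M)%R; [intros; apply Cmod_ge_0|].
  intros N. apply Rle_trans with (sum_n (fun n => / k * Cmod (f n * g n))%R N).
  - apply Rsum_le. intros n. rewrite Cmod_mult, <- Rmult_assoc.
    rewrite <- (Rmult_1_l (Cmod (g n))) at 1. apply Rmult_le_compat_r; [apply Cmod_ge_0|].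
    rewrite <- (Rinv_l k) by lra. apply Rmult_le_compat_l; [|apply Hf].
    now apply Rlt_le, Rinv_0_lt_compat.
  - rewrite Rsum_scal. apply Rmult_le_compat_l; [|apply HM].
    now apply Rlt_le, Rinv_0_lt_compat.
Qed.

Lemma Phi1_convergent (a b c x y : C) :
  not_qpole a q -> not_qpole c q -> ex_CDseries (Phi1_term a b c q x y) ->
  Cabs_summable (qbin_term b x) /\ Cabs_summable (qbin_term 0 y).
Proof.
  intros Ha Hc [M HM].
  destruct (qpoch_ratio_bounded_below a c Ha Hc) as (k & Hk & Hle).
  assert (E0 : forall b x, qbin_term b x 0 = 1).
  { intros. unfold qbin_term. simpl. field. }
  split; apply Cabs_summable_of_weighted
    with (fun n => qpoch a q n / qpoch c q n) k M; auto; intros N.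
  - specialize (HM N 0%nat). eapply Rle_trans; [|exact HM]. right.
    apply sum_n_ext. intros n.
    rewrite Rsum_0, Phi1_term_qbin, E0, Nat.add_0_r by exact Hc. now rewrite Cmult_1_r.
  - specialize (HM 0%nat N). eapply Rle_trans; [|exact HM]. right.
    rewrite Rsum_0. apply sum_n_ext. intros n.
    now rewrite Phi1_term_qbin, E0, Cmult_1_l by exact Hc.
Qed.

Lemma qpoch_ratio_qbin (a d : C) (n : nat) :
  not_qpole a q -> not_qpole (d * a) q -> Cabs_summable (qbin_term d a) ->
  qpoch a q n / qpoch (d * a) q n
  = qpoch_inf a q / qpoch_inf (d * a) q * CSeries (qbin_term d (a * q ^ n)).
Proof.
  intros Ha Hc H.
  assert (B := q_binomial d (a * q ^ n) (Cabs_summable_qbin_shift d a n H)).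
  rewrite Cmult_assoc in B.
  assert (Hcn := qpoch_inf_neq_0 _ (not_qpole_shift _ q n q_neq_0 Hc)).
  assert (Hn := qpoch_neq_0 _ q n q_neq_0 Hc).
  rewrite (qpoch_inf_split a n), (qpoch_inf_split (d * a) n), <- B.
  rewrite <- B in Hcn. field.
  repeat split; auto; intros E; apply Hcn; rewrite E; ring.
Qed.

Lemma q_binomial_shift (b x : C) (s : nat) :
  not_qpole x q -> not_qpole (b * x) q -> Cabs_summable (qbin_term b x) ->
  CSeries (qbin_term b (x * q ^ s))
  = qpoch_inf (b * x) q / qpoch_inf x q * (qpoch x q s / qpoch (b * x) q s).
Proof.
  intros Hx Hbx H.
  assert (B := q_binomial b (x * q ^ s) (Cabs_summable_qbin_shift b x s H)).
  rewrite Cmult_assoc in B.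
  assert (Hxs := qpoch_inf_neq_0 _ (not_qpole_shift _ q s q_neq_0 Hx)).
  assert (Hxn := qpoch_neq_0 _ q s q_neq_0 Hx).
  assert (Hn := qpoch_neq_0 _ q s q_neq_0 Hbx).
  rewrite (qpoch_inf_split x s), (qpoch_inf_split (b * x) s), <- B. field.
  repeat split; assumption.
Qed.

Lemma qbin_partial_sum_close (b x : C) (N s : nat) :
  Cabs_summable (qbin_term b x) ->
  (Cmod (sum_n (qbin_term b (x * q ^ s)) N - CSeries (qbin_term b (x * q ^ s)))
   <= Series (fun n => Cmod (qbin_term b x n)) - sum_n (fun n => Cmod (qbin_term b x n)) N)%R.
Proof.
  intros H. apply CSeries_tail_le; [|exact H].
  intros n. rewrite qbin_term_mult, Cmod_mult.
  rewrite <- (Rmult_1_r (Cmod (qbin_term b x n))) at 2.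
  apply Rmult_le_compat_l; [apply Cmod_ge_0|apply Cmod_qpow_le_1].
Qed.

Lemma qbin_partial_sum_le (b x : C) (N s : nat) :
  Cabs_summable (qbin_term b x) ->
  (Cmod (sum_n (qbin_term b (x * q ^ s)) N) <= Series (fun n => Cmod (qbin_term b x n)))%R.
Proof.
  intros H. eapply Rle_trans; [apply Csum_Cmod_le|].
  eapply Rle_trans; [|apply Rsum_le_Series with (n := N); [intros; apply Cmod_ge_0|exact H]].
  apply Rsum_le. intros n. rewrite qbin_term_mult, Cmod_mult.
  rewrite <- (Rmult_1_r (Cmod (qbin_term b x n))) at 2.
  apply Rmult_le_compat_l; [apply Cmod_ge_0|apply Cmod_qpow_le_1].
Qed.

Lemma qbin_sum_le (b x : C) (s : nat) :
  Cabs_summable (qbin_term b x) ->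
  (Cmod (CSeries (qbin_term b (x * q ^ s))) <= Series (fun n => Cmod (qbin_term b x n)))%R.
Proof.
  intros H.
  apply is_Clim_Cmod_le with (sum_n (qbin_term b (x * q ^ s))).
  - now apply CSeries_correct, Cabs_summable_qbin_shift.
  - intros N. now apply qbin_partial_sum_le.
Qed.

Lemma is_Clim_qbin_double_sum (a b d x y : C) :
  Cabs_summable (qbin_term d a) -> Cabs_summable (qbin_term b x) ->
  Cabs_summable (qbin_term 0 y) ->
  is_Clim
    (fun N => sum_n (fun n => sum_n (fun k =>
       qbin_term b x n * qbin_term 0 y k * CSeries (qbin_term d (a * q ^ (n + k)))) N) N)
    (CSeries (fun s => qbin_term d a s *
       (CSeries (qbin_term b (x * q ^ s)) * CSeries (qbin_term 0 (y * q ^ s))))).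
Proof.
  intros Hu Hv Hw.
  set (V := Series (fun n => Cmod (qbin_term b x n))).
  set (W := Series (fun n => Cmod (qbin_term 0 y n))).
  assert (HV : (0 <= V)%R) by (apply Series_nonneg; auto using Cmod_ge_0).
  apply is_Clim_CSeries with
    (fun N s => sum_n (qbin_term b (x * q ^ s)) N * sum_n (qbin_term 0 (y * q ^ s)) N)
    (fun N => (V - sum_n (fun n => Cmod (qbin_term b x n)) N) * W
              + V * (W - sum_n (fun n => Cmod (qbin_term 0 y n)) N))%R
    (V * W)%R; auto.
  - intros s. rewrite Cmod_mult.
    apply Rmult_le_compat; auto using Cmod_ge_0, qbin_sum_le.
  - intros N s.
    set (P := sum_n (qbin_term b (x * q ^ s)) N).
    set (Q := sum_n (qbin_term 0 (y * q ^ s)) N).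
    set (P' := CSeries (qbin_term b (x * q ^ s))).
    set (Q' := CSeries (qbin_term 0 (y * q ^ s))).
    replace (P * Q - P' * Q') with ((P - P') * Q + P' * (Q - Q')) by ring.
    eapply Rle_trans; [apply Cmod_triangle|]. rewrite !Cmod_mult.
    apply Rplus_le_compat; apply Rmult_le_compat; try apply Cmod_ge_0.
    + now apply qbin_partial_sum_close.
    + now apply qbin_partial_sum_le.
    + now apply qbin_sum_le.
    + now apply qbin_partial_sum_close.
  - assert (T : forall f, ex_series f -> is_lim_seq (fun N => Series f - sum_n f N)%R 0).
    { intros f Hf. replace (Finite 0) with (Finite (Series f - Series f)) by (f_equal; ring).
      apply is_lim_seq_minus'; [apply is_lim_seq_const|]. now apply Series_correct. }
    replace (Finite 0) with (Finite (0 * W + V * 0)) by (f_equal; ring).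
    apply is_lim_seq_plus'; apply is_lim_seq_mult';
      first [apply is_lim_seq_const | now apply T].
  - intros N. eapply is_Cseries_ext; [|apply is_Cseries_sum; intros n;
      apply is_Cseries_sum; intros k; apply is_Cseries_scal, CSeries_correct,
      Cabs_summable_qbin_shift, Hu].
    intros s. cbv beta.
    replace (qbin_term d a s *
      (sum_n (qbin_term b (x * q ^ s)) N * sum_n (qbin_term 0 (y * q ^ s)) N))
      with (qbin_term d a s * sum_n (qbin_term 0 (y * q ^ s)) N
            * sum_n (qbin_term b (x * q ^ s)) N) by ring.
    rewrite <- Csum_scal. apply Csum_ext. intros n.
    replace (qbin_term d a s * sum_n (qbin_term 0 (y * q ^ s)) N * qbin_term b (x * q ^ s) n)
      with (qbin_term d a s * qbin_term b (x * q ^ s) n * sum_n (qbin_term 0 (y * q ^ s)) N)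
      by ring.
    rewrite <- Csum_scal. apply Csum_ext. intros k.
    rewrite !qbin_term_mult, Cpow_add_r, Cpow_mult_l, <- !Cpow_mult_r.
    rewrite (Nat.mul_comm n s), (Nat.mul_comm k s). ring.
Qed.

Lemma Phi1_eq_phi32 (a b d x y : C) :
  not_qpole (d * a) q -> not_qpole x q -> not_qpole y q -> not_qpole (b * x) q ->
  ex_CDseries (Phi1_term a b (d * a) q x y) ->
  ex_Cseries (phi32_term d x y (b * x) 0 q a) ->
  Phi1 a b (d * a) q x y
  = (qpoch_inf a q * qpoch_inf (b * x) q)
    / (qpoch_inf (d * a) q * qpoch_inf x q * qpoch_inf y q)
    * phi32 d x y (b * x) 0 q a.
Proof.
  intros Hc Hx Hy Hbx HPhi Hphi.
  destruct (phi32_convergent d a x y (b * x) Hc Hx Hy Hbx Hphi) as [Hu Ha].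
  destruct (Phi1_convergent a b (d * a) x y Ha Hc HPhi) as [Hv Hw].
  assert (Nc := qpoch_inf_neq_0 _ Hc). assert (Nx := qpoch_inf_neq_0 _ Hx).
  assert (Ny := qpoch_inf_neq_0 _ Hy).
  set (K := qpoch_inf a q / qpoch_inf (d * a) q).
  set (L := qpoch_inf (b * x) q / (qpoch_inf x q * qpoch_inf y q)).
  assert (H0 : not_qpole (0 * y) q).
  { apply not_qpole_lt1. rewrite Cmult_0_l, Cmod_0. lra. }
  assert (E : CSeries (fun s => qbin_term d a s *
       (CSeries (qbin_term b (x * q ^ s)) * CSeries (qbin_term 0 (y * q ^ s))))
     = L * phi32 d x y (b * x) 0 q a).
  { apply is_Cseries_CSeries.
    eapply is_Cseries_ext;
      [|apply is_Cseries_scal, CSeries_correct, (Cabs_summable_phi32 d x y (b * x) a Hbx Hu)].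
    intros s. cbv beta. rewrite phi32_term_qbin by exact Hbx.
    rewrite !q_binomial_shift by assumption.
    rewrite Cmult_0_l, qpoch_inf_0_l, qpoch_0_l. unfold L. field.
    repeat split; auto. apply qpoch_neq_0; auto using q_neq_0. }
  unfold Phi1, CDSeries.
  replace (qpoch_inf a q * qpoch_inf (b * x) q
    / (qpoch_inf (d * a) q * qpoch_inf x q * qpoch_inf y q) * phi32 d x y (b * x) 0 q a)
    with (K * (L * phi32 d x y (b * x) 0 q a)) by (unfold K, L; field; auto).
  rewrite <- E. apply is_Clim_CLim.
  eapply is_Clim_ext;
    [|apply is_Clim_mult; [apply (is_Clim_const K)|
      apply (is_Clim_qbin_double_sum a b d x y Hu Hv Hw)]].
  intros N. cbv beta. rewrite <- Csum_scal. apply Csum_ext. intros n.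
  rewrite <- Csum_scal. apply Csum_ext. intros k.
  rewrite Phi1_term_qbin, qpoch_ratio_qbin by assumption. unfold K. ring.
Qed.

End Convergence.

Lemma Cexp_plus (z w : C) : Cexp (z + w) = Cexp z * Cexp w.
Proof.
  destruct z as [z1 z2], w as [w1 w2]. unfold Cexp, Cplus, Cmult. simpl.
  rewrite exp_plus, cos_plus, sin_plus. f_equal; ring.
Qed.

Theorem theorem2p11 (q lq alpha beta gamma x y : C)
  (hq0 : (0 < Cmod q)%R) (hq1 : (Cmod q < 1)%R) (hlq : Cexp lq = q)
  (hgamma : not_qpole (qpow lq gamma) q) :
  ((Cmod x < 1)%R -> (Cmod y < 1)%R ->
   ex_CDseries (Phi1_term (qpow lq alpha) (qpow lq beta) (qpow lq gamma) q x y))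
  /\
  ((Cmod (qpow lq alpha) < 1)%R -> not_qpole (qpow lq beta * x) q ->
   ex_Cseries (phi32_term (qpow lq (gamma - alpha)) x y
                 (qpow lq beta * x) 0 q (qpow lq alpha)))
  /\
  (ex_CDseries (Phi1_term (qpow lq alpha) (qpow lq beta) (qpow lq gamma) q x y) ->
   ex_Cseries (phi32_term (qpow lq (gamma - alpha)) x y
                 (qpow lq beta * x) 0 q (qpow lq alpha)) ->
   not_qpole x q -> not_qpole y q -> not_qpole (qpow lq beta * x) q ->
   Phi1 (qpow lq alpha) (qpow lq beta) (qpow lq gamma) q x y
   = (qpoch_inf (qpow lq alpha) q * qpoch_inf (x * qpow lq beta) q)
     / (qpoch_inf (qpow lq gamma) q * qpoch_inf x q * qpoch_inf y q)
     * phi32 (qpow lq (gamma - alpha)) x y (qpow lq beta * x) 0 q (qpow lq alpha)).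
Proof.
  assert (Hg : qpow lq gamma = qpow lq (gamma - alpha) * qpow lq alpha).
  { unfold qpow. rewrite <- Cexp_plus. f_equal. ring. }
  rewrite Hg in *. split; [|split].
  - now apply ex_CDseries_Phi1.
  - intros Ha Hbx. apply Cabs_summable_ex.
    apply Cabs_summable_phi32; auto. now apply Cabs_summable_qbin.
  - intros HPhi Hphi Hx Hy Hbx.
    rewrite (Cmult_comm x (qpow lq beta)). now apply Phi1_eq_phi32.
Qed.
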